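(* For all $n\ge 1$, $|\mathscr{O}^{\mathrm{UPF}}_n|=|\mathrm{UPF}^{\mathrm{T1}}_{n,2\mathbb{Z}^+}|$.
   Context: A parking preference $(a_1,\dots,a_n)\in[n]^n$ describes $n$ cars entering a one-way street with spots $1,\dots,n$ in the order $1,2,\dots,n$; car $i$ parks in the first unoccupied spot numbered $\ge a_i$. It is a parking function if all cars park. It is a unit interval parking function (UPF) if it is a parking function and every car $i$ parks in spot $a_i$ or spot $a_i+1$. Car $i$ is lucky if it parks in spot $a_i$. $\mathrm{UPF}^{\mathrm{T1}}_{n,2\mathbb{Z}^+}$ is the set of UPFs of length $n$ whose number of lucky cars is a positive even integer. Block structure: let $\alpha^{\uparrow}=(a_1',\dots,a_n')$ be the weakly increasing rearrangement of $\alpha$. The indices $i$ with $a'_i=i$ are block starts; the block structure $\pi_1|\cdots|\pi_k$ cuts $\alpha^{\uparrow}$ into consecutive segments, each beginning at a block start. Distinct blocks contain distinct values, so each entry $a_j$ of $\alpha$ lies in a well-defined block. A UPF $\alpha=(a_1,\dots,a_n)$ has no cyclical adjacencies if two conditions hold. First, for every $1\le j\le n-1$, the entries $a_j$ and $a_{j+1}$ do not lie in the same block. Second, $a_1$ and $a_n$ do not lie in the same block. $\mathscr{O}^{\mathrm{UPF}}_n$ is the set of UPFs of length $n$ with no cyclical adjacencies. *)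

(* Defs.v *)
From mathcomp Require Import all_boot.

Set Implicit Arguments.
Unset Strict Implicit.
Unset Printing Implicit Defensive.

(* Cars, spots and preferences are numbered from 0 instead of 1: a preference
   in [n]^n is an n.-tuple 'I_n, and every value and index is shifted by -1.
   The predicates below act on the underlying list s of natural numbers, whose
   size is the number n of cars and of spots. *)
Definition preference (n : nat) := n.-tuple 'I_n.

Definition entries (n : nat) (a : preference n) : seq nat :=
  [seq val x | x <- a].

(* First spot >= a, among 0, ..., n - 1, not in occ; the value is n, which is
   not a spot, when there is none. *)
Definition first_spot (n : nat) (occ : seq nat) (a : nat) : nat :=
  find (fun p => (a <= p) && (p \notin occ)) (iota 0 n).

(* A car that fails to park adds the non-spot n to occ, so it blocks no one. *)
Fixpoint park (n : nat) (occ s : seq nat) : seq nat :=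
  if s is a :: s' then
    let p := first_spot n occ a in p :: park n (p :: occ) s'
  else [::].

Definition outcome (s : seq nat) : seq nat := park (size s) [::] s.

Definition parking_function (s : seq nat) : bool :=
  all (fun p => p < size s) (outcome s).

Definition unit_interval_pf (s : seq nat) : bool :=
  parking_function s &&
  all2 (fun a p => (p == a) || (p == a.+1)) s (outcome s).

Definition num_lucky (s : seq nat) : nat :=
  count (fun ap => ap.2 == ap.1) (zip s (outcome s)).

Definition rearrangement (s : seq nat) : seq nat := sort leq s.

Definition block_starts (s : seq nat) : seq nat :=
  [seq i <- iota 0 (size s) | nth 0 (rearrangement s) i == i].

(* Each segment runs from a block start to just before the next one, or to the
   end of the list. The segments cover the whole list when 0 is a block start,
   as it is for every parking function. *)
Definition block_structure (s : seq nat) : seq (seq nat) :=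
  let st := block_starts s in
  [seq drop ij.1 (take ij.2 (rearrangement s))
     | ij <- zip st (rcons (behead st) (size s))].

Definition same_block (s : seq nat) (x y : nat) : bool :=
  has (fun b : seq nat => (x \in b) && (y \in b)) (block_structure s).

Definition no_cyclical_adjacency (s : seq nat) : bool :=
  all (fun j => ~~ same_block s (nth 0 s j) (nth 0 s j.+1))
      (iota 0 (size s).-1) &&
  ~~ same_block s (nth 0 s 0) (nth 0 s (size s).-1).

Definition UPF_no_cyc_adj (n : nat) : {set preference n} :=
  [set a : preference n |
    unit_interval_pf (entries a) && no_cyclical_adjacency (entries a)].

Definition UPF_even_lucky (n : nat) : {set preference n} :=
  [set a : preference n |
    [&& unit_interval_pf (entries a), 0 < num_lucky (entries a)
      & ~~ odd (num_lucky (entries a))]].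

(* Main.v *)
Require Import Defs.
From mathcomp Require Import all_boot zify.

(** A unit interval parking function is the same thing as an ordered set
    partition of its cars, that is a word [w] whose letters are exactly
    [0, ..., k - 1]: [w_i] is the index of the block of car [i], the lucky cars
    are the first occurrences of the [k] letters, and the spot of car [i] is the
    rank of [(w_i, i)] in lexicographic order.  Under this correspondence the
    lucky cars are counted by [k], and having no cyclical adjacency means that
    cyclically consecutive letters differ.

    Let [C_n] and [E_n] count the words of length [n] with this cyclic property,
    respectively with [k] even.  A word without equal neighbours either is
    cyclically proper or becomes so when its last letter, equal to the first, is
    deleted, so [C_(n+1) + C_n] counts the words of length [n + 1] without equal
    neighbours, and this number is the sum of [k + 1] over all words of length
    [n].  Appending a letter to a word with [k] letters repeats an old letter in
    [k] ways and inserts a new one in [k + 1] ways, so [E_(n+1) + E_n] is the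
    same sum; hence [C_n = E_n] by induction from [C_1 = E_1 = 0]. *)

Set Implicit Arguments.
Unset Strict Implicit.
Unset Printing Implicit Defensive.

(** * Words using exactly the letters 0, ..., k - 1 *)

Definition letters (w : seq nat) := size (undup w).

Definition packed (w : seq nat) := forall x, (x \in w) = (x < letters w).

(** The last letter repeats an earlier one, or is a new letter [j], and then [bump j] shifts the
    letters [>= j] up to make room. *)
Fixpoint words (n : nat) : seq (seq nat) :=
  if n is n'.+1 then
    [seq rcons w j | w <- words n', j <- iota 0 (letters w)] ++
    [seq rcons (map (bump j) w) j | w <- words n', j <- iota 0 (letters w).+1]
  else [:: [::]].
Arguments words : simpl never.

Lemma wordsS n : words n.+1 =
  [seq rcons w j | w <- words n, j <- iota 0 (letters w)] ++
  [seq rcons (map (bump j) w) j | w <- words n, j <- iota 0 (letters w).+1].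
Proof. by []. Qed.

Lemma letters_rcons w x :
  letters (rcons w x) = if x \in w then letters w else (letters w).+1.
Proof.
rewrite /letters (perm_size (perm_undup (mem_rcons w x))) /=.
by case: (x \in w).
Qed.

Lemma letters_map_inj f w : injective f -> letters (map f w) = letters w.
Proof. by move=> fI; rewrite /letters undup_map_inj // size_map. Qed.

Lemma bump_inj h : injective (bump h).
Proof. exact: can_inj (@bumpK h). Qed.

Lemma notin_map_bump h w : h \notin map (bump h) w.
Proof. by apply/mapP=> -[x _ /eqP]; rewrite (negPf (neq_bump h x)). Qed.

Lemma letters_rcons_bump h w :
  letters (rcons (map (bump h) w) h) = (letters w).+1.
Proof.
rewrite letters_rcons (negPf (notin_map_bump h w)) letters_map_inj //.
exact: bump_inj.
Qed.

Lemma packed_rcons_old w j : packed w -> j < letters w -> packed (rcons w j).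
Proof.
move=> pw jw x; have jin : j \in w by rewrite pw.
rewrite letters_rcons jin mem_rcons inE -pw.
by case: eqP => // ->.
Qed.

Lemma packed_rcons_new w j :
  packed w -> j <= letters w -> packed (rcons (map (bump j) w) j).
Proof.
move=> pw jw x; rewrite letters_rcons_bump mem_rcons inE.
have [->|xj] /= := eqVneq x j; first by lia.
have -> : x = bump j (unbump j x) by rewrite unbumpKcond (negPf xj).
rewrite mem_map; last exact: bump_inj.
by rewrite pw /bump /unbump; lia.
Qed.

(** Deleting the last letter inverts the recursion of [words]: a new letter [x] leaves a gap that
    [unbump x] closes. *)
Lemma packed_rconsE w x : packed (rcons w x) ->
  (packed w /\ x < letters w) \/
  exists w', [/\ packed w', x <= letters w' & w = map (bump x) w'].
Proof.
move=> pw; case: (boolP (x \in w)) => xw; [left | right].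
  have pw' : packed w.
    move=> y; have := pw y; rewrite letters_rcons xw mem_rcons inE => <-.
    by case: eqP => // ->.
  by split=> //; rewrite -pw'.
have E : w = map (bump x) (map (unbump x) w).
  rewrite -map_comp -[LHS]map_id; apply/eq_in_map => y yw /=.
  rewrite unbumpKcond; case: eqP => // yx.
  by rewrite -yx yw in xw.
exists (map (unbump x) w); split=> //; last first.
  have := pw x; rewrite letters_rcons (negPf xw) mem_rcons mem_head.
  by rewrite {1}E letters_map_inj; [move=> /esym | exact: bump_inj].
move=> y; rewrite -(mem_map (@bump_inj x)) -E.
have := pw (bump x y); rewrite letters_rcons (negPf xw) mem_rcons inE.
rewrite eq_sym (negPf (neq_bump x y)) /= => ->.
have := pw x; rewrite letters_rcons (negPf xw) mem_rcons mem_head => /esym.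
rewrite {1 2}E letters_map_inj; last exact: bump_inj.
by rewrite /bump; lia.
Qed.

Lemma words_packed n w : reflect (size w = n /\ packed w) (w \in words n).
Proof.
apply: (iffP idP); elim: n w => [|n IHn] w.
- by rewrite inE => /eqP ->.
- rewrite mem_cat => /orP[] /allpairsPdep[v [j [/IHn[sv pv]]]];
    rewrite mem_iota /= => jv ->; rewrite size_rcons ?size_map sv; split=> //.
    exact: packed_rcons_old.
  exact: packed_rcons_new.
- by case=> /size0nil->.
case/lastP: w => [[]//|w x]; rewrite size_rcons => -[[sw] /packed_rconsE[]].
  move=> [pw xw]; rewrite mem_cat; apply/orP; left; apply/allpairsPdep.
  by exists w, x; rewrite mem_iota IHn.
move=> [v [pv xv Ew]]; rewrite mem_cat; apply/orP; right; apply/allpairsPdep.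
by exists v, x; rewrite mem_iota -Ew IHn // -sw Ew size_map.
Qed.

Lemma words_uniq n : uniq (words n).
Proof.
elim: n => // n IHn; rewrite wordsS cat_uniq; apply/and3P; split.
- apply: allpairs_uniq_dep => // [w _|]; first exact: iota_uniq.
  move=> [w j] [v i] _ _ /= /eqP; rewrite eqseq_rcons => /andP[/eqP-> /eqP->//].
(* The two lists are disjoint: only in the first does the last letter occur earlier. *)
- apply/hasPn=> _ /allpairsPdep[v [j [_ _ ->]]]; apply/negP=> /allpairsPdep.
  move=> [w [i [/words_packed[_ pw]]]]; rewrite mem_iota /= -pw => iw /eqP.
  rewrite eqseq_rcons => /andP[/eqP Ew /eqP Ei].
  by move: iw; rewrite -Ew -Ei (negPf (notin_map_bump _ _)).
apply: allpairs_uniq_dep => // [w _|]; first exact: iota_uniq.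
move=> [w j] [v i] _ _ /= /eqP; rewrite eqseq_rcons => /andP[/eqP + /eqP Ej].
by rewrite Ej => /(inj_map (@bump_inj i)) ->.
Qed.

Lemma sum_wordsS n (F : seq nat -> nat) :
  \sum_(w <- words n.+1) F w =
  \sum_(w <- words n) (\sum_(j < letters w) F (rcons w j) +
     \sum_(j < (letters w).+1) F (rcons (map (bump j) w) j)).
Proof.
rewrite wordsS big_cat [RHS]big_split !big_allpairs_dep.
congr addn; apply: eq_bigr => w _.
  by rewrite -(big_mkord xpredT (fun j => F (rcons w j))) /index_iota subn0.
by rewrite -(big_mkord xpredT (fun j => F (rcons (map (bump j) w) j))) /index_iota subn0.
Qed.

(** * Words with unequal neighbours, and parity of the number of letters *)

Definition neq : rel nat := fun x y => x != y.

(* The weight g lets the identity be proved for all k at once by induction. *)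
Lemma sum_sorted_words n (g : nat -> nat) :
  \sum_(w <- words n.+1) sorted neq w * g (letters w) =
  \sum_(w <- words n) (letters w).+1 * g (letters w).+1.
Proof.
elim: n g => [|n IHn] g.
  rewrite sum_wordsS !big_seq1 /= big_ord0 big_ord1 /= /letters /=; lia.
rewrite sum_wordsS [RHS]sum_wordsS.
(* From a word with [k] letters and unequal neighbours, [k - 1] old letters differ from the last
   one, and all [k + 1] new letters do. *)
transitivity (\sum_(w <- words n.+1) sorted neq w *
    ((letters w).-1 * g (letters w) + (letters w).+1 * g (letters w).+1)).
  rewrite big_seq [RHS]big_seq; apply: eq_bigr => -[|x p].
    by case/words_packed.
  case/words_packed=> _ pw; set w := x :: p.
  rewrite mulnDr; congr addn.
    have lw : last x p < letters w by rewrite -pw mem_last.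
    rewrite (eq_bigr (fun j => sorted neq w * g (letters w) *
        (j != Ordinal lw))) => [|j _]; last first.
      rewrite letters_rcons pw ltn_ord /= rcons_path -mulnb -val_eqE /= /neq.
      by rewrite eq_sym mulnAC.
    have -> : (letters w).-1 = \sum_(j < letters w) (j != Ordinal lw).
      rewrite -[in LHS](card_ord (letters w)) -(cardC1 (Ordinal lw)) -sum1_card.
      by rewrite big_mkcond; apply: eq_bigr => j _; rewrite !inE; case: (_ == _).
    by rewrite -big_distrr /= mulnAC mulnA.
  rewrite (eq_bigr (fun=> sorted neq w * g (letters w).+1)); last first.
    move=> i _; rewrite letters_rcons_bump /= rcons_path.
    have -> : path neq (bump i x) (map (bump i) p) = sorted neq w.
      rewrite path_map; apply: eq_path => y z /=.
      by rewrite /neq (inj_eq (@bump_inj i)).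
    by rewrite last_map /neq eq_sym neq_bump andbT.
  by rewrite sum_nat_const card_ord mulnCA.
(* The bracket depends on [k] alone, so it serves as a new weight. *)
rewrite (IHn (fun k => k.-1 * g k + k.+1 * g k.+1)) big_seq [RHS]big_seq.
apply: eq_bigr => w /words_packed[_ pw].
rewrite (eq_bigr (fun=> (letters w).+1 * g (letters w).+1)); last first.
  by move=> i _; rewrite letters_rcons pw ltn_ord.
rewrite [X in _ = _ + X](eq_bigr (fun=> (letters w).+2 * g (letters w).+2)); last first.
  by move=> i _; rewrite letters_rcons_bump.
rewrite !sum_nat_const !card_ord /=; nia.
Qed.

Lemma count_sum (T : Type) (P : pred T) s : count P s = \sum_(x <- s) P x.
Proof. by rewrite -sum1_count big_mkcond; apply: eq_bigr => x _; case: (P x). Qed.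

Lemma count_cycle_words n :
  count (cycle neq) (words n.+2) + count (cycle neq) (words n.+1) =
  \sum_(w <- words n.+1) (letters w).+1.
Proof.
rewrite [RHS](eq_bigr (fun w => (letters w).+1 * 1)) => [|w _]; last by rewrite muln1.
rewrite -(sum_sorted_words n.+1 (fun=> 1)).
(* The cycle condition only adds that the last letter differs from the first. *)
have split_sorted x p j : sorted neq (rcons (x :: p) j) =
    cycle neq (rcons (x :: p) j) + (sorted neq (rcons (x :: p) j) && (j == x)) :> nat.
  by rewrite /= !rcons_path last_rcons /neq; case: (_ && _); case: (j == x).
rewrite !count_sum !(sum_wordsS n.+1) -big_split /= big_seq [RHS]big_seq.
apply: eq_bigr => -[|x p /words_packed[_ pw]]; first by case/words_packed.
rewrite addnAC; congr (_ + _); last first.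
  (* A new letter never equals the first one, which [bump j] has moved off [j]. *)
  apply: eq_bigr => j _; rewrite muln1 [RHS]split_sorted.
  by rewrite (negPf (neq_bump j x)) andbF addn0.
have xw : x < letters (x :: p) by rewrite -pw mem_head.
(* Among the old letters only [j = x] equals the first one; it supplies the term
   [cycle neq (x :: p)]. *)
rewrite [RHS](eq_bigr (fun j : 'I_(letters (x :: p)) =>
    cycle neq (rcons (x :: p) j) + (cycle neq (x :: p) && (j == Ordinal xw)))).
  rewrite big_split /=; congr (_ + _); rewrite (bigD1 (Ordinal xw)) //= eqxx andbT.
  by rewrite big1 ?addn0 // => j /negPf->; rewrite andbF.
move=> j _; rewrite muln1 [LHS]split_sorted -val_eqE /=.
by case: eqP => [->|]; rewrite ?andbF.
Qed.

Definition even_letters (w : seq nat) := (0 < letters w) && ~~ odd (letters w).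

Lemma count_even_words n :
  count even_letters (words n.+2) + count even_letters (words n.+1) =
  \sum_(w <- words n.+1) (letters w).+1.
Proof.
rewrite !count_sum (sum_wordsS n.+1) -big_split /= big_seq [RHS]big_seq.
apply: eq_bigr => -[|x p /words_packed[_ pw]]; first by case/words_packed.
set w := x :: p in pw *; have w0 : 0 < letters w.
  by have := pw x; rewrite mem_head => /esym; lia.
(* With [k] letters, the [k] old choices keep the parity and the [k + 1] new ones flip it; adding
   the word itself when [k] is even gives [k + 1] in both cases. *)
rewrite (eq_bigr (fun=> even_letters w : nat)); last first.
  by move=> j _; rewrite /even_letters letters_rcons pw ltn_ord.
rewrite [X in _ + X + _](eq_bigr (fun=> odd (letters w) : nat)); last first.
  by move=> j _; rewrite /even_letters letters_rcons_bump /= negbK.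
rewrite !sum_nat_const !card_ord /even_letters w0 /=.
by case: odd; lia.
Qed.

Lemma count_cycle_even_words n :
  count (cycle neq) (words n.+1) = count even_letters (words n.+1).
Proof.
elim: n => [|n IHn]; first by [].
by apply/eqP; rewrite -(eqn_add2r (count even_letters (words n.+1)))
  -{1}IHn count_cycle_words count_even_words.
Qed.

(** * Unit interval parking functions and their blocks *)

(* The outcome p of s, described without running the parking process. *)
Definition unit_parking (s p : seq nat) :=
  [/\ size p = size s, uniq p, all (fun t => t < size s) p
    & forall i, i < size s -> nth 0 p i = nth 0 s i \/
        nth 0 p i = (nth 0 s i).+1 /\ nth 0 s i \in take i p].

Lemma first_spotP n occ a b : b < n ->
  reflect [/\ a <= b, b \notin occ & forall c, a <= c < b -> c \in occ]
          (first_spot n occ a == b).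
Proof.
move=> bn; rewrite /first_spot; set P := (fun p => _).
apply: (iffP eqP) => [E | [ab bocc Hc]].
  have hP : has P (iota 0 n) by rewrite has_find E size_iota.
  have := nth_find 0 hP; rewrite E nth_iota // add0n => /andP[ab bocc].
  split=> // c /andP[ac cb]; have := @before_find _ 0 P (iota 0 n) c.
  rewrite E nth_iota ?add0n; last exact: ltn_trans bn.
  by rewrite /P ac => /(_ cb) /negbFE.
have fb : find P (iota 0 n) <= b.
  rewrite leqNgt; apply/negP=> bf; have := before_find 0 bf.
  by rewrite nth_iota // add0n /P ab bocc.
apply/eqP; rewrite eqn_leq fb leqNgt /=; apply/negP=> fltb.
have hP : has P (iota 0 n) by rewrite has_find size_iota; apply: leq_ltn_trans bn.
have := nth_find 0 hP; rewrite nth_iota ?add0n; last by apply: leq_ltn_trans bn.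
by case/andP=> af /negP; apply; apply: Hc; rewrite af.
Qed.

Lemma size_park n occ s : size (park n occ s) = size s.
Proof. by elim: s occ => //= a s IHs occ; rewrite IHs. Qed.

Lemma nth_park n occ s i : i < size s ->
  nth 0 (park n occ s) i =
  first_spot n (catrev (take i (park n occ s)) occ) (nth 0 s i).
Proof. by elim: s occ i => //= a s IHs occ [|i] //= /IHs ->. Qed.

Lemma size_outcome s : size (outcome s) = size s.
Proof. exact: size_park. Qed.

Lemma nth_outcome s i : i < size s ->
  nth 0 (outcome s) i = first_spot (size s) (rev (take i (outcome s))) (nth 0 s i).
Proof. exact: nth_park. Qed.

(** Once the earlier spots agree, [nth 0 p i] is free because [p] is duplicate-free, and the only
    spot car [i] could meet before it is its own preference, already taken. *)
Lemma unit_parking_outcome s p : unit_parking s p -> outcome s = p.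
Proof.
case=> sp up /(all_nthP 0) pn H.
have E i : i <= size s -> take i (outcome s) = take i p.
  elim: i => [|i IHi] si; first by rewrite !take0.
  rewrite !(take_nth 0) ?size_outcome ?sp // IHi 1?ltnW //; congr rcons.
  apply/eqP; rewrite nth_outcome // IHi 1?ltnW //.
  apply/first_spotP; first by apply: pn; rewrite sp.
  have notin : nth 0 p i \notin rev (take i p).
    rewrite mem_rev in_take_leq; last by rewrite sp ltnW.
    by rewrite index_uniq ?ltnn ?sp.
  case: (H i si) => [E|[E sin]]; split=> //; rewrite E // => c Hc; first by lia.
  by have -> : c = nth 0 s i by [lia]; rewrite mem_rev.
by have := E _ (leqnn _); rewrite -{1}size_outcome -{1}sp !take_size.
Qed.

(** If the first free spot is [a + 1], then [a] is taken; and a spot free on arrival differs from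
    all earlier ones, which gives [uniq]. *)
Lemma unit_interval_parking s :
  unit_interval_pf s <-> unit_parking s (outcome s).
Proof.
split=> [/andP[an]|[so uo an H]]; last first.
  apply/andP; split=> //; rewrite all2E size_outcome eqxx /=.
  apply/(all_nthP (0, 0)) => i; rewrite size_zip size_outcome minnn => si.
  rewrite nth_zip ?size_outcome //=.
  by case: (H i si) => [->|[-> _]]; rewrite eqxx ?orbT.
rewrite all2E size_outcome eqxx /= => /(all_nthP (0, 0)).
rewrite size_zip size_outcome minnn => H.
have {}H i : i < size s -> nth 0 (outcome s) i \notin take i (outcome s) /\
   (nth 0 (outcome s) i = nth 0 s i \/
     nth 0 (outcome s) i = (nth 0 s i).+1 /\ nth 0 s i \in take i (outcome s)).
  move=> si; have := H i si; rewrite nth_zip ?size_outcome //=.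
  have pi : nth 0 (outcome s) i < size s.
    by move/(all_nthP 0): an; apply; rewrite size_outcome.
  have /first_spotP : first_spot (size s) (rev (take i (outcome s))) (nth 0 s i)
    == nth 0 (outcome s) i by rewrite -nth_outcome.
  case/(_ pi)=> _; rewrite mem_rev => pni Hc /orP[/eqP E|/eqP E]; split=> //.
    by left.
  by right; split=> //; rewrite -mem_rev; apply: Hc; lia.
split=> //; [exact: size_outcome | | by move=> i /H[]].
have lt i j : i < j < size s -> nth 0 (outcome s) i <> nth 0 (outcome s) j.
  case/andP=> ij js E; case: (H j js) => /negP[]; rewrite -E.
  by rewrite -(nth_take 0 ij) mem_nth // size_takel // size_outcome ltnW.
apply/(uniqP 0) => i j; rewrite !inE size_outcome => si sj E.
by case: (ltngtP i j) => // ij; [case: (lt i j) | case: (lt j i)]; rewrite ?ij.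
Qed.

(** The intervals are disjoint, and the one containing [x] is identified by the number of left
    endpoints [<= x]. The induction compares [x] and [y] with the second endpoint. *)
Lemma has_interval_count a L m x y : path ltn a L -> a <= x < m -> a <= y < m ->
  has (fun ij => (ij.1 <= x < ij.2) && (ij.1 <= y < ij.2)) (zip (a :: L) (rcons L m)) =
  (count (fun b => b <= x) (a :: L) == count (fun b => b <= y) (a :: L)).
Proof.
move=> + /andP[+ xm] /andP[+ ym]; elim: L a => [|b L IHL] a.
  by move=> _ /= -> ->; rewrite xm ym.
rewrite [path _ _ _]/= => /andP[ab pL] ax ay.
have gt z : z < b -> count (fun c => c <= z) (b :: L) = 0.
  move=> zb; apply/eqP; rewrite -leqn0 leqNgt -has_count; apply/hasPn=> c.
  have /allP H := order_path_min ltn_trans pL.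
  by rewrite inE -ltnNge => /predU1P[->//|/H]; apply: ltn_trans.
have le z : b <= z -> 0 < count (fun c => c <= z) (b :: L) by move=> /= ->.
have hasF z (Q : pred (nat * nat)) : z < b -> subpred Q (fun ij => ij.1 <= z) ->
    has Q (zip (b :: L) (rcons L m)) = false.
  move=> /gt zb /sub_has QP; apply/negbTE/negP=> /QP.
  rewrite -(has_map fst (fun i => i <= z)) -/(unzip1 _) unzip1_zip ?size_rcons //.
  by rewrite has_count zb.
rewrite -[zip _ _]/((a, b) :: zip (b :: L) (rcons L m)).
rewrite -[has _ _]/(_ || has _ (zip (b :: L) (rcons L m))).
have cE z : a <= z -> count (fun c => c <= z) [:: a, b & L] =
    (count (fun c => c <= z) (b :: L)).+1 by move=> /= ->.
rewrite !cE // eqSS [(a, b).1]/= [(a, b).2]/= ax ay {cE}.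
case: (ltnP x b) (ltnP y b) => [xb|bx] [yb|yb]; rewrite [_ || _]/=.
- by rewrite !gt.
- rewrite (hasF x) => //; last by move=> ij /andP[/andP[]].
  by rewrite gt // eq_sym gtn_eqF // le.
- rewrite (hasF y) => //; last by move=> ij /andP[_ /andP[]].
  by rewrite (gt y) // gtn_eqF // le.
by rewrite IHL.
Qed.

Lemma count_leq_nth_sorted L c : sorted ltn L -> c < size L ->
  count (fun b => b <= nth 0 L c) L = c.+1.
Proof.
elim: L c => //= a L IHL [|c] pL cL; have /allP H := order_path_min ltn_trans pL.
  rewrite leqnn; congr _.+1; apply/eqP; rewrite -leqn0 leqNgt -has_count.
  by apply/hasPn=> b /H; rewrite ltnNge.
by rewrite IHL ?(path_sorted pL) //= ltnW ?H ?mem_nth.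
Qed.

Lemma perm_iota_uniq p :
  uniq p -> all (fun t => t < size p) p -> perm_eq p (iota 0 (size p)).
Proof.
move=> up /allP pn; apply: uniq_perm => //; first exact: iota_uniq.
have sub : {subset p <= iota 0 (size p)} by move=> t /pn; rewrite mem_iota.
by have [] := uniq_min_size up sub; rewrite ?size_iota.
Qed.

Section Parked.

Variables s p : seq nat.
Hypothesis sp : unit_parking s p.

Let n := size s.
Let r t := nth 0 (rearrangement s) t.

Lemma size_spots : size p = n. Proof. by case: sp. Qed.

Lemma spots_lt i : i < n -> nth 0 p i < n.
Proof.
by case: sp => sz _ /(all_nthP 0) H _ ni; apply: H; rewrite sz.
Qed.

Lemma perm_spots : perm_eq p (iota 0 n).
Proof.
by case: sp => sz up pn _; rewrite /n -sz; apply: perm_iota_uniq; rewrite ?sz.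
Qed.

Lemma spotE t : t < n -> index t p < n /\ nth 0 p (index t p) = t.
Proof.
move=> tn; have tp : t \in p by rewrite (perm_mem perm_spots) mem_iota.
by rewrite -size_spots index_mem nth_index.
Qed.

(** Preferences listed by spot already increase weakly: the car in spot [t] prefers at most [t], the
    one in spot [t + 1] at least [t]. *)
Lemma rearrangementE :
  rearrangement s = mkseq (fun t => nth 0 s (index t p)) n.
Proof.
case: (sp) => sz up pn H.
apply: (sorted_eq leq_trans anti_leq); first exact: (sort_sorted leq_total).
  apply/(sortedP 0) => t; rewrite size_mkseq => tn.
  have tn' := ltnW tn; rewrite !nth_mkseq //.
  have [i1 i1E] := spotE tn'; have [i2 i2E] := spotE tn.
  have := H _ i1; have := H _ i2; rewrite i1E i2E.
  by move=> [E2|[E2 _]] [E1|[E1 _]]; lia.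
rewrite perm_sort perm_sym.
have {2}-> : s = map (fun t => nth 0 s (index t p)) p.
  apply: (@eq_from_nth _ 0); rewrite ?size_map ?sz // => i si.
  by rewrite (nth_map 0) ?sz // index_uniq ?sz.
by apply: perm_map; rewrite perm_sym; exact: perm_spots.
Qed.

Lemma nth_rearrangement_spot i : i < n -> r (nth 0 p i) = nth 0 s i.
Proof.
case: (sp) => sz up _ _ ni.
by rewrite /r rearrangementE nth_mkseq ?spots_lt // index_uniq ?sz.
Qed.

(** [r t] is the preference of the car in spot [t]: that car is lucky, or was pushed on by the car
    already in spot [t - 1]. *)
Lemma rearrangement_cases t : t < n ->
  r t = t \/ t = (r t).+1 /\ index (r t) p < index t p.
Proof.
move=> tn; have [ni pi] := spotE tn; case: (sp) => sz up _ /(_ _ ni).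
rewrite -nth_rearrangement_spot // pi => -[<-|[E]]; first by left.
by rewrite in_take_leq ?sz; [right | exact: ltnW].
Qed.

Lemma mem_block_starts t : (t \in block_starts s) = (t < n) && (r t == t).
Proof. by rewrite mem_filter mem_iota andbC. Qed.

Lemma block_starts_sorted : sorted ltn (block_starts s).
Proof. by apply: sorted_filter; [exact: ltn_trans | exact: iota_ltn_sorted]. Qed.

Lemma block_starts_head : 0 < n -> exists L, block_starts s = 0 :: L.
Proof.
move=> n0; have := mem_block_starts 0; rewrite n0.
have -> : r 0 == 0 by case: (rearrangement_cases n0) => [->|[]].
have := block_starts_sorted; case: block_starts => //= -[|a] L; first by exists L.
move=> /(order_path_min ltn_trans)/allP H; by rewrite inE => /= /H.
Qed.

Lemma num_lucky_block_starts : num_lucky s = size (block_starts s).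
Proof.
rewrite /num_lucky (unit_parking_outcome sp).
have {1}-> : s = map r p.
  case: (sp) => sz _ _ _; apply: (@eq_from_nth _ 0); rewrite ?size_map ?sz // => i si.
  by rewrite (nth_map 0) ?sz // nth_rearrangement_spot.
have -> : zip (map r p) p = map (fun t => (r t, t)) p.
  by elim: (p) => //= t q ->.
rewrite count_map size_filter; move/permP: perm_spots => ->.
by apply: eq_count => t /=; rewrite eq_sym.
Qed.

(** The number, from 1, of the block containing [t]. *)
Definition block_index (t : nat) := count (fun b => b <= t) (block_starts s).

Lemma block_indexS t :
  block_index t.+1 = block_index t + (t.+1 \in block_starts s).
Proof.
rewrite /block_index -count_uniq_mem; last by rewrite filter_uniq ?iota_uniq.
rewrite -count_predUI [X in _ = _ + X](@eq_count _ _ pred0) ?count_pred0 ?addn0.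
  by apply: eq_count => b /=; lia.
by move=> b /=; lia.
Qed.

Lemma block_index_mono t u : t <= u -> block_index t <= block_index u.
Proof. by move=> tu; apply: sub_count => b /= bt; apply: leq_trans tu. Qed.

Lemma block_index_gt0 t : 0 < n -> 0 < block_index t.
Proof. by case/block_starts_head => L; rewrite /block_index => ->. Qed.

(** An unlucky car parks right after its preference, in a spot that is not a block start, so no
    block boundary is crossed. *)
Lemma block_index_spot i : i < n ->
  block_index (nth 0 s i) = block_index (nth 0 p i).
Proof.
move=> ni; have pn := spots_lt ni.
have := nth_rearrangement_spot ni; case: (rearrangement_cases pn) => [-> -> //|].
case=> E _ rE; rewrite rE in E; rewrite E block_indexS mem_block_starts -E rE.
by rewrite (_ : (nth 0 s i == nth 0 p i) = false) ?andbF ?addn0 //; lia.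
Qed.

(** Position [t] of the rearrangement carries [t] or [t - 1], and a block start carries itself, so
    the values of a segment stay in the range of its positions. *)
Lemma mem_segment a b x : x \in s ->
  (a, b) \in zip (block_starts s) (rcons (behead (block_starts s)) n) ->
  (x \in drop a (take b (rearrangement s))) = (a <= x < b).
Proof.
move=> xs abL; have szR : size (rearrangement s) = n by rewrite size_sort.
have aL : a \in block_starts s.
  have := map_f fst abL; rewrite -/(unzip1 _) unzip1_zip //.
  by rewrite size_rcons size_behead; case: size.
have bL : b = n \/ b \in block_starts s.
  have := map_f snd abL; rewrite -/(unzip2 _) unzip2_zip /=; last first.
    by rewrite size_rcons size_behead; case: block_starts aL.
  rewrite mem_rcons inE => /predU1P[->|/mem_behead]; first by left.
  by right.
move: aL; rewrite mem_block_starts => /andP[an /eqP ra].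
apply/(nthP 0)/idP => [[i]|/andP[ax xb]].
  rewrite size_drop size_take_min szR => ib; rewrite nth_drop nth_take -/(r _); last by lia.
  move=> <-; have tn : a + i < n by lia.
  case: i ib tn => [|i] ib tn; first by rewrite addn0 ra; lia.
  by case: (rearrangement_cases tn) => [->|[]]; lia.
move: xs; rewrite -(mem_sort leq) => /(nthP 0)[t]; rewrite -/(rearrangement s) szR => tn rt.
(* The value [x] sits at position [x] or [x + 1]; the latter cannot be a block start [b], which
   carries [b]. *)
have [at_ tb] : a <= t /\ t < b.
  case: (rearrangement_cases tn); rewrite /r rt; first by lia.
  move=> [E _].
  split; first by lia.
  case: bL => [->//|]; rewrite mem_block_starts => /andP[bn /eqP rb].
  rewrite ltn_neqAle; apply/andP; split; last by lia.
  apply/eqP=> tb; rewrite -tb /r rt in rb; lia.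
exists (t - a); first by rewrite size_drop size_take_min szR; lia.
by rewrite nth_drop nth_take subnKC.
Qed.

Lemma same_blockE x y : x \in s -> y \in s ->
  same_block s x y = (block_index x == block_index y).
Proof.
move=> xs ys; have n0 : 0 < n by rewrite /n; case: (s) xs.
have sn z : z \in s -> z < n.
  move=> /(nthP 0)[i ni <-]; have := spots_lt ni; rewrite -nth_rearrangement_spot //.
  by case: (rearrangement_cases (spots_lt ni)) => [->|[]]; lia.
rewrite /same_block /block_structure has_map.
rewrite (eq_in_has (a2 := fun ij => (ij.1 <= x < ij.2) && (ij.1 <= y < ij.2))).
  have := block_starts_sorted; rewrite /block_index.
  have [L ->] := block_starts_head n0 => pL.
  by rewrite has_interval_count ?sn.
by move=> [i j] ijL /=; rewrite !mem_segment.
Qed.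

Definition code := [seq (block_index x).-1 | x <- s].

Lemma size_code : size code = n. Proof. exact: size_map. Qed.

Lemma nth_code i : i < n -> (nth 0 code i).+1 = block_index (nth 0 p i).
Proof.
move=> ni; rewrite (nth_map 0) // prednK ?block_index_spot //.
by apply: block_index_gt0; apply: leq_ltn_trans ni.
Qed.

Lemma same_block_code i j : i < n -> j < n ->
  same_block s (nth 0 s i) (nth 0 s j) = (nth 0 code i == nth 0 code j).
Proof.
by move=> ni nj; rewrite same_blockE ?mem_nth // -[RHS]eqSS !nth_code // !block_index_spot.
Qed.

Lemma mem_code c : (c \in code) = (c < num_lucky s).
Proof.
rewrite num_lucky_block_starts.
apply/mapP/idP => [[x xs ->]|cL].
  rewrite prednK; first exact: count_size.
  by apply: block_index_gt0; rewrite /n; case: (s) xs.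
(* The letter [c] comes from the block start of index [c], itself a preference. *)
have := mem_nth 0 cL; set t := nth 0 _ c; rewrite mem_block_starts => /andP[tn /eqP rt].
exists t; last by rewrite /block_index count_leq_nth_sorted ?block_starts_sorted.
by rewrite -rt -(mem_sort leq) mem_nth // size_sort.
Qed.

Lemma no_cyclical_adjacencyE : 0 < n -> no_cyclical_adjacency s = cycle neq code.
Proof.
move=> n0; have : size code = size s := size_code.
have sb := same_block_code; move: sb; rewrite /no_cyclical_adjacency /n in n0 *.
case: code => [|x w] sb /= sz; first by rewrite -sz in n0.
rewrite rcons_path -sz -/(size w); congr (_ && _).
  apply/allP/(pathP 0) => H i.
    move=> iw; have := H i; rewrite mem_iota /= => /(_ iw).
    by rewrite sb -?sz //= ltnS ltnW.
  rewrite mem_iota /= => iw; have := H i iw.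
  by rewrite sb -?sz //= ltnS ltnW.
rewrite sb -?sz //= /neq eq_sym (last_nth 0); by case: (size w).
Qed.

End Parked.

(** * Decoding a word *)

Lemma count_ltn (T : eqType) (A B : pred T) s x :
  x \in s -> subpred A B -> B x -> ~~ A x -> count A s < count B s.
Proof.
move=> + AB Bx Ax; elim: s => //= y s IHs; rewrite inE.
have sB := sub_count AB s; have yAB := AB y.
case/predU1P => [<-|/IHs lt]; first by rewrite Bx (negPf Ax); lia.
by case: (A y) yAB => [->//|_]; lia.
Qed.

Lemma count_iota_ltn n m : m <= n -> count (fun t => t < m) (iota 0 n) = m.
Proof.
move=> mn; rewrite -(subnKC mn) iotaD count_cat add0n.
rewrite (@eq_in_count _ _ xpredT) => [|t]; last by rewrite mem_iota.
rewrite count_predT size_iota [X in _ + X](@eq_in_count _ _ pred0) => [|t].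
  by rewrite count_pred0 addn0.
by rewrite mem_iota /=; lia.
Qed.

Definition before (w : seq nat) (j i : nat) :=
  (nth 0 w j < nth 0 w i) || (nth 0 w j == nth 0 w i) && (j < i).

Definition rank (w : seq nat) (i : nat) :=
  count (fun j => before w j i) (iota 0 (size w)).

(* The subtracted boolean is 1 exactly for the unlucky cars. *)
Definition decode (w : seq nat) : seq nat :=
  mkseq (fun i => rank w i - (nth 0 w i \in take i w)) (size w).

Definition ranks (w : seq nat) : seq nat := mkseq (rank w) (size w).

Lemma before_rank w i j : i < size w -> before w i j -> rank w i < rank w j.
Proof.
move=> iw bij; apply: (@count_ltn _ _ _ _ i) => //; first by rewrite mem_iota.
  by move=> l; move: bij; rewrite /before; lia.
by rewrite /before; lia.
Qed.

Lemma rank_ltE w i j : i < size w -> j < size w ->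
  (rank w i < rank w j) = before w i j.
Proof.
move=> iw jw; apply/idP/idP => [|/before_rank->//]; apply: contraTT => nb.
have [->|ij] := eqVneq i j; first by rewrite ltnn.
rewrite -leqNgt ltnW // before_rank //.
by move: nb ij; rewrite /before; lia.
Qed.

Lemma rank_lt_size w i : i < size w -> rank w i < size w.
Proof.
move=> iw; rewrite -[X in _ < X](size_iota 0) -(count_predT (iota _ _)).
by apply: (@count_ltn _ _ _ _ i); rewrite ?mem_iota // /before; lia.
Qed.

Lemma rank_inj w : {in gtn (size w) &, injective (rank w)}.
Proof.
move=> i j; rewrite !inE => iw jw E; apply/eqP/negPn/negP => ij.
have := rank_ltE iw jw; have := rank_ltE jw iw; rewrite E ltnn /before.
by move: ij; lia.
Qed.

Lemma size_ranks w : size (ranks w) = size w. Proof. exact: size_mkseq. Qed.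

Lemma size_decode w : size (decode w) = size w. Proof. exact: size_mkseq. Qed.

Lemma mem_takeP (w : seq nat) i x : i <= size w ->
  reflect (exists2 j, j < i & nth 0 w j = x) (x \in take i w).
Proof.
move=> iw; apply: (iffP (nthP 0)); rewrite size_takel // => -[j ji];
  by rewrite ?nth_take // => E; exists j; rewrite ?nth_take.
Qed.

Lemma repeat_before w i : i < size w -> nth 0 w i \in take i w ->
  exists j, [/\ j < i, nth 0 w j = nth 0 w i & rank w j < rank w i].
Proof.
move=> iw /(mem_takeP _ (ltnW iw))[j ji E]; exists j; split=> //.
by apply: before_rank; rewrite ?(ltn_trans ji) // /before E eqxx ji orbT.
Qed.

Lemma unit_parking_decode w : unit_parking (decode w) (ranks w).
Proof.
have ur : uniq (ranks w) by apply/mkseq_uniqP; exact: rank_inj.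
have ar : all (fun t => t < size w) (ranks w).
  by apply/allP=> _ /mapP[i + ->]; rewrite mem_iota; exact: rank_lt_size.
split; rewrite ?size_ranks ?size_decode // => i iw.
rewrite !nth_mkseq //; case: (boolP (nth 0 w i \in _)); last by rewrite subn0; left.
move=> /(repeat_before iw)[j [ji wji rji]]; right; split; first by lia.
(* The ranks fill an initial segment, so some car [l] has the rank just below that of [i]. *)
have : rank w i - true \in ranks w.
  rewrite (perm_mem (perm_iota_uniq ur _)) size_ranks //.
  by rewrite mem_iota; have := rank_lt_size iw; lia.
case/mapP => l; rewrite mem_iota => /= lw rl; rewrite rl.
apply/mem_takeP; first by rewrite size_ranks ltnW.
exists l; last by rewrite nth_mkseq.
have jw := ltn_trans ji iw.
(* [l] lies weakly after [j] and before [i] in lexicographic order; as [j] and [i] share a letter,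
   [l] has it too, so [l < i]. *)
have := rank_ltE lw iw; have := rank_ltE lw jw; rewrite /before wji.
by lia.
Qed.

Lemma count_first_occurrences (P : pred nat) w :
  count (fun j => (nth 0 w j \notin take j w) && P (nth 0 w j)) (iota 0 (size w)) =
  count P (undup w).
Proof.
elim/last_ind: w => // w x IHw.
move/permP: (perm_undup (mem_rcons w x)) => ->.
rewrite size_rcons -addn1 iotaD count_cat add0n.
rewrite [X in X + _](@eq_in_count _ _
  (fun j => (nth 0 w j \notin take j w) && P (nth 0 w j))).
  rewrite IHw /= nth_rcons ltnn eqxx -cats1 take_size_cat // addn0.
  by case: (x \in w) => //=; rewrite ?addn0 // addnC.
move=> j; rewrite mem_iota => /= jw.
by rewrite nth_rcons jw -cats1 takel_cat // ltnW.
Qed.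

(** Truncated subtraction does no harm: a repeated letter has an equal one before it, hence positive
    rank. *)
Lemma decode_eq_rank w i : i < size w ->
  (nth 0 (decode w) i == rank w i) = (nth 0 w i \notin take i w).
Proof.
move=> iw; rewrite nth_mkseq //.
case: (boolP (_ \in _)) => [/(repeat_before iw)[j [_ _]]|_]; last by rewrite subn0 eqxx.
by lia.
Qed.

Lemma nth_ranks w i : i < size w -> nth 0 (ranks w) i = rank w i.
Proof. exact: nth_mkseq. Qed.

(** The block starts of [decode w] are the ranks of first occurrences. Those up to [rank w i] belong
    to the letters up to [nth 0 w i], which number [(nth 0 w i).+1] as [w] is packed. *)
Lemma decodeK w : packed w -> code (decode w) = w.
Proof.
move=> pw; have up := unit_parking_decode w; have sd := size_decode w.
apply: (@eq_from_nth _ 0); rewrite size_code sd // => i iw.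
apply: succn_inj; rewrite (nth_code up) ?sd // nth_ranks //.
rewrite /block_index /block_starts count_filter.
move/permP: (perm_spots up) => <-.
rewrite count_map /=.
rewrite (@eq_in_count _ _ (fun j => (nth 0 w j \notin take j w) && (nth 0 w j <= nth 0 w i))).
  rewrite (count_first_occurrences (fun x => x <= nth 0 w i)).
  have /permP -> : perm_eq (undup w) (iota 0 (letters w)).
    by apply: uniq_perm; rewrite ?undup_uniq ?iota_uniq // => x; rewrite mem_undup pw mem_iota.
  by rewrite -[RHS](@count_iota_ltn (letters w)) // -pw mem_nth.
move=> j; rewrite mem_iota /= => jw.
rewrite -[X in nth _ _ X](nth_ranks jw) (nth_rearrangement_spot up) ?sd //.
rewrite decode_eq_rank // andbC; case: (boolP (_ \in _)) => //= wj.
(* A first occurrence [j] of the letter of [i] cannot come after [i], so letters alone decide the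
   comparison. *)
rewrite [rank w j <= _]leqNgt rank_ltE // /before.
have : nth 0 w i = nth 0 w j -> i < j -> False.
  by move=> E ij; case/negP: wj; apply/(mem_takeP _ (ltnW jw)); exists i.
by lia.
Qed.

Section Decode.

Variables s p : seq nat.
Hypothesis sp : unit_parking s p.

Let n := size s.

(* An unlucky car at spot u prefers u - 1, which must already be taken. *)
Lemma block_time_order t u : t < u < n -> block_index s t = block_index s u ->
  index t p < index u p.
Proof.
elim: u => [|u IHu]; first by lia.
rewrite ltnS => /andP[tu un]; have mono := block_index_mono s tu; rewrite block_indexS => E.
have : u.+1 \notin block_starts s /\ block_index s t = block_index s u.
  by case: (_ \in _) E mono => /= E mono; lia.
rewrite (mem_block_starts s) un /= => -[ru E'].
case: (rearrangement_cases sp un) => [r|[[<-] lt]]; first by rewrite r eqxx in ru.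
move: tu; rewrite leq_eqVlt => /predU1P[->//|tu]; apply: ltn_trans lt.
by apply: IHu => //; rewrite tu ltnW.
Qed.

(** Block numbers increase weakly with the spot, and inside a block the spots fill in order of
    arrival. *)
Lemma before_code i j : i < n -> j < n ->
  before (code s) j i = (nth 0 p j < nth 0 p i).
Proof.
move=> ni nj; rewrite /before -ltnS -[_ == _]eqSS !(nth_code sp) //.
case: (sp) => sz up _ _.
have pI : nth 0 p i = nth 0 p j -> i = j.
  by move/eqP; rewrite nth_uniq ?sz // => /eqP.
have idx l : l < n -> index (nth 0 p l) p = l by move=> nl; rewrite index_uniq ?sz.
have pi := spots_lt sp ni; have pj := spots_lt sp nj.
have tij := @block_time_order (nth 0 p i) (nth 0 p j).
have tji := @block_time_order (nth 0 p j) (nth 0 p i).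
have mij := @block_index_mono s (nth 0 p i) (nth 0 p j).
have mji := @block_index_mono s (nth 0 p j) (nth 0 p i).
rewrite !idx // in tij tji.
have [lt|lt|/esym/pI->] := ltngtP (nth 0 p j) (nth 0 p i); last by rewrite !ltnn andbF.
  rewrite lt pi in tji; move: (mji (ltnW lt)).
  by rewrite leq_eqVlt => /predU1P[E|->//]; rewrite E eqxx tji ?orbT.
rewrite lt pj in tij; have := mij (ltnW lt).
case: eqP => [E|_]; last by lia.
by have := tij isT (esym E); lia.
Qed.

Lemma rank_code i : i < n -> rank (code s) i = nth 0 p i.
Proof.
move=> ni; rewrite /rank size_code.
rewrite (@eq_in_count _ _ (preim (nth 0 p) (fun t => t < nth 0 p i))).
  rewrite -count_map -(size_spots sp) map_nth_iota0 // take_size.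
  move/permP: (perm_spots sp) => ->.
  by rewrite count_iota_ltn // ltnW // spots_lt.
by move=> j; rewrite mem_iota => /= nj; rewrite before_code.
Qed.

Lemma codeK : decode (code s) = s.
Proof.
apply: (@eq_from_nth _ 0); rewrite size_decode size_code // => i ni.
rewrite nth_mkseq ?size_code // rank_code //.
case: (sp) => sz up _ /(_ i ni) H; have sc := size_code s.
case: (boolP (_ \in _)) => [/(repeat_before _)|].
  rewrite sc => /(_ ni)[j [ji E]]; have nj := ltn_trans ji ni.
  rewrite !rank_code // => lt; case: H => [Es|[-> _]]; last by rewrite subn1.
  (* A lucky car would occupy a block start, putting the lower spot of [j] in an earlier block,
     against the shared letter. *)
  have : nth 0 p i \in block_starts s.
    by rewrite mem_block_starts spots_lt // (nth_rearrangement_spot sp) // Es eqxx.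
  case: (nth 0 p i) lt (nth_code sp ni) => // t; rewrite ltnS => tj.
  rewrite block_indexS => + tin.
  rewrite tin -E (nth_code sp nj); have := block_index_mono s tj; lia.
(* An unlucky car shares its block with the earlier car in its preferred spot, so its letter would
   be a repetition. *)
move=> Hn; rewrite subn0; case: H => [//|[Es /(mem_takeP _)]].
rewrite sz => /(_ (ltnW ni))[j ji Ej]; case/negP: Hn.
have nj := ltn_trans ji ni.
apply/mem_takeP; first by rewrite sc ltnW.
exists j => //; apply: succn_inj; rewrite !(nth_code sp) //.
by rewrite Ej (block_index_spot sp).
Qed.

End Decode.

(** * Counting unit interval parking functions by words *)

Lemma letters_code s p : unit_parking s p -> letters (code s) = num_lucky s.
Proof.
move=> sp; rewrite -[RHS](size_iota 0); apply/perm_size/uniq_perm.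
- exact: undup_uniq.
- exact: iota_uniq.
by move=> c; rewrite mem_undup (mem_code sp) mem_iota.
Qed.

Lemma packed_code s p : unit_parking s p -> packed (code s).
Proof. by move=> sp c; rewrite (mem_code sp) (letters_code sp). Qed.

Lemma entries_inj n : injective (@entries n).
Proof. by move=> a b /(inj_map val_inj) /val_inj. Qed.

Lemma entriesP n s : size s = n -> all (fun x => x < n) s ->
  exists a : preference n, entries a = s.
Proof.
move=> sn /allP an; have sz : size (pmap (insub : nat -> option 'I_n) s) == n.
  rewrite size_pmap_sub -[X in _ == X]sn -all_count; exact/allP.
exists (Tuple sz); rewrite /entries /= (pmap_filter (insubK _)).
by apply/all_filterP/allP => x /an xn; rewrite insubT.
Qed.

(** [decode] maps [words n] bijectively onto the unit interval parking functions, with inverse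
    [code], so any property can be counted on words. *)
Lemma card_unit_interval_pf n (P : pred (seq nat)) :
  #|[set a : preference n | unit_interval_pf (entries a) && P (entries a)]| =
  count (fun w => P (decode w)) (words n).
Proof.
rewrite cardE -(size_map (@entries n)) -size_filter -[RHS](size_map decode).
apply/perm_size/uniq_perm.
- by rewrite (map_inj_uniq (@entries_inj n)) enum_uniq.
- rewrite map_inj_in_uniq ?filter_uniq ?words_uniq // => v w.
  rewrite !mem_filter => /andP[_ /words_packed[_ pv]] /andP[_ /words_packed[_ pw]].
  by move=> E; rewrite -(decodeK pv) E decodeK.
move=> s; apply/mapP/mapP => [[a]|[w]].
  rewrite mem_enum inE => /andP[/unit_interval_parking up Pa] ->.
  exists (code (entries a)); last by rewrite (codeK up).
  rewrite mem_filter (codeK up) Pa; apply/words_packed.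
  by rewrite size_code size_map size_tuple; split=> //; exact: packed_code up.
rewrite mem_filter => /andP[Pw /words_packed[sw pw]] ->.
have up := unit_parking_decode w.
have [||a aE] := @entriesP n (decode w); first by rewrite size_decode.
  apply/(all_nthP 0) => i; rewrite size_decode => iw.
  rewrite nth_mkseq // -sw; exact: leq_ltn_trans (leq_subr _ _) (rank_lt_size iw).
exists a => //; rewrite mem_enum inE aE Pw andbT; apply/unit_interval_parking.
by rewrite (unit_parking_outcome up).
Qed.

Theorem theorem3p15 (n : nat) (hn : 1 <= n) :
  #|UPF_no_cyc_adj n| = #|UPF_even_lucky n|.
Proof.
rewrite (card_unit_interval_pf n no_cyclical_adjacency).
rewrite (card_unit_interval_pf n (fun s => (0 < num_lucky s) && ~~ odd (num_lucky s))).
case: n hn => // n _.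
(* As [code (decode w)] is [w], both properties of [decode w] are read off [w] itself. *)
rewrite (@eq_in_count _ _ (cycle neq)) => [|w /words_packed[sw pw]].
  rewrite count_cycle_even_words; apply: eq_in_count => w /words_packed[sw pw].
  by rewrite -(letters_code (unit_parking_decode w)) decodeK.
rewrite (no_cyclical_adjacencyE (unit_parking_decode w)) ?size_decode ?sw //.
by rewrite decodeK.
Qed.
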